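(* For any fan poset $P=\mathcal V(\ell_1,\ldots,\ell_k)$ with $\ell_1\ge\cdots\ge\ell_k\ge2$, the limit $\pi(P)=\lim_{n\to\infty}\mathrm{La}(n,P)/\binom{n}{\lfloor n/2\rfloor}$ exists and $\pi(P)=e(P)=\ell_1-1$.
   Context: All posets are finite and nonempty. Let $[n]=\{1,\dots,n\}$; families of subsets of $[n]$ are ordered by inclusion. A poset $(P,\le)$ contains a poset $(P',\le')$ as a (weak) subposet if there is an injection $f:P'\to P$ such that $u\le' v$ implies $f(u)\le f(v)$. A family $\mathcal F\subseteq 2^{[n]}$ is $P$-free if it does not contain $P$ in this sense. $\mathrm{La}(n,P)$ is the largest size of a $P$-free family $\mathcal F\subseteq 2^{[n]}$. $e(P)$ is the maximum integer $k\ge 0$ such that for all integers $n$ and $s$ the family $\binom{[n]}{s}\cup\binom{[n]}{s+1}\cup\cdots\cup\binom{[n]}{s+k-1}$ is $P$-free, where $\binom{[n]}{j}$ is the collection of $j$-element subsets of $[n]$ (empty if $j<0$ or $j>n$). Let $\mathcal P_\ell$ denote the chain with $\ell$ elements. For $k\ge1$ and $\ell_1\ge\cdots\ge\ell_k\ge2$, the fan $\mathcal V(\ell_1,\ldots,\ell_k)$ is the poset obtained from disjoint chains $\mathcal P_{\ell_1},\ldots,\mathcal P_{\ell_k}$ by identifying their minimum elements (elements of different chains other than the common minimum are incomparable). *)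

(* Defs.v *)
From HB Require Import structures.
From mathcomp Require Import all_boot all_order all_algebra.
From mathcomp Require Import all_classical all_reals all_analysis.
Set Implicit Arguments.
Unset Strict Implicit.
Unset Printing Implicit Defensive.
Import Order.TTheory GRing.Theory Num.Theory.
Import numFieldNormedType.Exports.

Local Open Scope ring_scope.

(* The ground set [n] is modelled by 'I_n. *)
Definition contains_poset (d : Order.disp_t) (n : nat)
    (F : {set {set 'I_n}}) (P : finPOrderType d) : Prop :=
  exists f : P -> {set 'I_n},
    [/\ injective f, (forall u, f u \in F)
      & forall u v : P, (u <= v)%O -> f u \subset f v].

Definition poset_free (d : Order.disp_t) (n : nat)
    (P : finPOrderType d) (F : {set {set 'I_n}}) : Prop :=
  ~ contains_poset F P.

Definition La (d : Order.disp_t) (n : nat) (P : finPOrderType d) : nat :=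
  (\max_(F : {set {set 'I_n}} | `[< poset_free P F >]) #|F|)%N.

(* The index j is an integer, so level n j is empty for j < 0 or j > n. *)
Definition level (n : nat) (j : int) : {set {set 'I_n}} :=
  [set A : {set 'I_n} | #|A|%:Z == j].

Definition consecutive_levels (n : nat) (s : int) (k : nat) :
    {set {set 'I_n}} :=
  (\bigcup_(i < k) level n (s + i%:Z))%SET.

Definition levels_free (d : Order.disp_t) (P : finPOrderType d)
    (k : nat) : Prop :=
  forall (n : nat) (s : int), poset_free P (consecutive_levels n s k).

Definition is_e (d : Order.disp_t) (P : finPOrderType d) (k : nat) : Prop :=
  levels_free P k /\ forall m : nat, levels_free P m -> (m <= k)%N.

(* A default value is returned when no maximum exists; by e_spec below this
   never happens for a nonempty poset. *)
Definition e (d : Order.disp_t) (P : finPOrderType d) : nat :=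
  get [set k | is_e P k]%classic.

Definition La_ratio (R : realType) (d : Order.disp_t) (P : finPOrderType d)
    (n : nat) : R :=
  (La n P)%:R / 'C(n, n./2)%:R.

Definition poset_pi (R : realType) (d : Order.disp_t)
    (P : finPOrderType d) : R :=
  limn (La_ratio R P).

(* None is the common minimum of the chains, and Some (Tagged _ j), with tag i,
   is the element of rank j.+1 in the i-th chain, which has nth 0 l i elements
   including the common minimum. *)
Definition fan (l : seq nat) : Type :=
  option {i : 'I_(size l) & 'I_(nth 0%N l i).-1}.

HB.instance Definition _ (l : seq nat) :=
  Finite.copy (fan l) (option {i : 'I_(size l) & 'I_(nth 0%N l i).-1}).

Definition fan_le (l : seq nat) (x y : fan l) : bool :=
  match x, y with
  | None, _ => true
  | Some _, None => false
  | Some a, Some b => (tag a == tag b) && (tagged a <= tagged b)%N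
  end.

Fact fan_display : Order.disp_t. Proof. exact: Order.Disp tt tt. Qed.

Lemma fan_le_refl (l : seq nat) : reflexive (@fan_le l).
Proof. by case=> [[i j]|] //=; rewrite eqxx leqnn. Qed.

Lemma fan_le_anti (l : seq nat) : antisymmetric (@fan_le l).
Proof.
case=> [[i j]|] [[i' j']|] //= /andP[/andP[/eqP eii' lejj'] /andP[_ lej'j]].
move: lejj' lej'j; case: _ / eii' j' => j' /= h1 h2.
by congr (Some (existT _ i _)); apply/val_inj/eqP; rewrite eqn_leq h1.
Qed.

Lemma fan_le_trans (l : seq nat) : transitive (@fan_le l).
Proof.
move=> [b|] [a|] [c|] //=.
case/andP=> /eqP e1 h1 /andP[/eqP e2 h2].
by apply/andP; split; [rewrite e1 e2 | exact: leq_trans h1 h2].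
Qed.

HB.instance Definition _ (l : seq nat) :=
  Order.Le_isPOrder.Build fan_display (fan l)
    (@fan_le_refl l) (@fan_le_anti l) (@fan_le_trans l).

Lemma e_spec (d : Order.disp_t) (P : finPOrderType d) (p0 : P) : is_e P (e P).
Proof.
suff [k ke] : exists k, is_e P k by exact: (@getI _ [set k | is_e P k]%classic k).
have ex : exists k, `[< levels_free P k >].
  exists 0%N; apply/asboolP => n s [f [_ /(_ p0) + _]].
  by rewrite /consecutive_levels big_ord0 inE.
have ub k : `[< levels_free P k >] -> (k <= #|P|)%N.
  move=> /asboolP fr; rewrite leqNgt; apply/negP => ltPk.
  apply: (fr #|P| 0).
  exists (fun x => [set i | (enum_val i <= x)%O]%SET); split.
  - move=> x y /setP exy; apply/le_anti/andP; split.
      by have := exy (enum_rank x); rewrite !inE enum_rankK lexx => <-.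
    by have := exy (enum_rank y); rewrite !inE enum_rankK lexx => ->.
  - move=> x; set A := [set i | _]%SET.
    have ltA : (#|A| < k)%N.
      by apply: leq_ltn_trans ltPk; rewrite -[leqRHS]card_ord max_card.
    by apply/bigcupP; exists (Ordinal ltA) => //; rewrite inE add0r.
  - move=> x y xy; apply/fintype.subsetP => i; rewrite !inE => h.
    exact: le_trans h xy.
case: (ex_maxnP ex ub) => k /asboolP fk kmax; exists k; split=> // m fm.
by apply: kmax; apply/asboolP.
Qed.

(* Main.v *)
Require Import Defs.
From HB Require Import structures.
From mathcomp Require Import all_boot all_order all_algebra.
From mathcomp Require Import all_fingroup zify lra.
From mathcomp Require Import all_classical all_reals all_analysis.
Set Implicit Arguments.
Unset Strict Implicit.
Unset Printing Implicit Defensive.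
Import Order.TTheory GRing.Theory Num.Theory.
Import numFieldNormedType.Exports.

(* Upper bound: let h be the length of the longest chain minus one, and let F
   be fan-free with all its sets of size at most n - M. For A in F take a
   maximal family of pairwise disjoint h-chains of F strictly above A; it has
   fewer than k members, so the at most k h sets occurring in it meet every
   h-chain of F above A. A uniformly random full chain through A contains a
   given larger set of F with probability at most 1 / M, hence continues through
   an h-chain of F with probability at most k h / M. If the full chain meets F
   in X sets, all of them but h start such a continuation, so
   E[X] <= h + (k h / M) E[X]. Since |F| / 'C(n, n./2) <= E[X], letting n and
   then M tend to infinity gives limsup La / 'C(n, n./2) <= h; the sets of size
   above n - M are negligible. Lower bound: the h levels from n./2 upwards. *)

(** * Full chains of subsets encoded by permutations, and how many pass through given sets *)

Section FullChains.
Import mathcomp.boot.fintype mathcomp.boot.finset.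
Local Open Scope nat_scope.

(** The i-th element of each colour class of [c] goes to the i-th element of the class of [c'] with
    the same colour. *)
Lemma colour_perm (T : finType) (K : eqType) (c c' : T -> K) :
  (forall k, #|[pred x | c x == k]| = #|[pred x | c' x == k]|) ->
  exists s : {perm T}, forall x, c' (s x) = c x.
Proof.
move=> eqc.
pose cls k := enum [pred y | c y == k].
pose cls' k := enum [pred y | c' y == k].
pose f x := nth x (cls' (c x)) (index x (cls (c x))).
have xcls x : x \in cls (c x) by rewrite mem_enum inE.
have ltf x : index x (cls (c x)) < size (cls' (c x)).
  by rewrite -[size _]cardE -eqc cardE index_mem.
have cf x : c' (f x) = c x.
  by apply/eqP; have := mem_nth x (ltf x); rewrite mem_enum inE.
have injf : injective f.
  move=> x y fxy; have cxy : c x = c y by rewrite -!cf fxy.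
  have := xcls y; have := xcls x; move: fxy (ltf x) (ltf y).
  rewrite /f cxy [RHS](set_nth_default x) // => + ltx lty xx yy.
  move/eqP; rewrite nth_uniq ?enum_uniq // => /eqP.
  by move/(congr1 (nth x (cls (c y)))); rewrite !nth_index.
by exists (perm injf) => x; rewrite permE.
Qed.

(** Colour the points by their membership in the two sets: the class sizes depend only on the sizes
    of these sets and of [T]. *)
Lemma flag_perm (T : finType) (A B A' B' : {set T}) :
  A \subset B -> A' \subset B' -> #|A| = #|A'| -> #|B| = #|B'| ->
  exists s : {perm T}, s @: A = A' /\ s @: B = B'.
Proof.
move=> sAB sAB' eA eB.
pose c (A B : {set T}) x := (x \in A, x \in B).
have classes (X Y : {set T}) k : X \subset Y ->
    #|[pred x | c X Y x == k]| =
    match k with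
    | (true, true) => #|X| | (false, true) => #|Y| - #|X|
    | (false, false) => #|T| - #|Y| | (true, false) => 0
    end.
  move=> sXY; case: k => -[] [] /=.
  - apply: eq_card => x; rewrite !inE /c xpair_eqE !eqb_id.
    by case: (boolP (x \in X)) => // /(subsetP sXY) ->.
  - apply: eq_card0 => x; rewrite !inE /c xpair_eqE eqb_id.
    by case: (boolP (x \in X)) => // /(subsetP sXY) ->.
  - rewrite -(cardsDS sXY); apply: eq_card => x.
    by rewrite !inE /c xpair_eqE eqb_id; case: (x \in X).
  - rewrite -[in _ - _](setCK Y) -cardsCs; apply: eq_card => x.
    rewrite !inE /c xpair_eqE.
    by move/subsetP/(_ x): sXY; case: (x \in X) => [->|]; case: (x \in Y).
have [|s cs] := @colour_perm _ _ (c A B) (c A' B').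
  by move=> k; rewrite !classes // eA eB.
have mems x : (s x \in A') = (x \in A) /\ (s x \in B') = (x \in B).
  by case: (cs x).
exists s; split; apply/setP => y; rewrite -[y](permKV s) mem_imset ?(mems _);
  by [case: (mems (s^-1 y)%g) | exact: perm_inj].
Qed.

Variable n : nat.
Implicit Types (A B : {set 'I_n}) (s : {perm 'I_n}).

(* The permutation s encodes the full chain of the sets s @: {0, ..., j - 1}. *)
Definition chain_set s j : {set 'I_n} := s @: [set i : 'I_n | i < j].

Definition on_chain s A := chain_set s #|A| == A.

Definition num_chains A B := #|[set s | on_chain s A && on_chain s B]|.

Lemma card_chain_set s j : j <= n -> #|chain_set s j| = j.
Proof.
move=> lejn; rewrite card_imset; last exact: perm_inj.
rewrite -sum1_card (eq_bigl (fun i : 'I_n => i < j)) => [|i];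
  last by rewrite inE.
by rewrite (big_ord_narrow lejn) sum1_card card_ord.
Qed.

Lemma chain_set_sub s i j : i <= j -> chain_set s i \subset chain_set s j.
Proof.
by move=> leij; apply/imsetS/subsetP=> k; rewrite !inE => /leq_trans; apply.
Qed.

Lemma leq_card_ord A : #|A| <= n.
Proof. by rewrite -[leqRHS]card_ord max_card. Qed.

Lemma on_chain_set s j : j <= n -> on_chain s (chain_set s j).
Proof. by move=> lejn; rewrite /on_chain card_chain_set. Qed.

Lemma on_chain_sub s A B :
  on_chain s A -> on_chain s B -> #|A| <= #|B| -> A \subset B.
Proof. by move=> /eqP eA /eqP eB /(chain_set_sub s); rewrite eA eB. Qed.

Lemma on_chain_perm s t A : on_chain (s * t)%g (t @: A) = on_chain s A.
Proof.
rewrite /on_chain card_imset; last exact: perm_inj.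
have -> : chain_set (s * t) #|A| = t @: chain_set s #|A|.
  by rewrite /chain_set -imset_comp; apply: eq_imset => i; rewrite permM.
by rewrite (inj_eq (imset_inj (@perm_inj _ t))).
Qed.

(** Right multiplication by a permutation carrying one flag to the other is a bijection between the
    two sets of chains. *)
Lemma num_chains_eq A B A' B' : A \subset B -> A' \subset B' ->
  #|A| = #|A'| -> #|B| = #|B'| -> num_chains A B = num_chains A' B'.
Proof.
move=> sAB sAB' eA eB; have [t [<- <-]] := flag_perm sAB sAB' eA eB.
rewrite /num_chains -!sum1_card [RHS](reindex_inj (mulIg t)) /=.
by apply: eq_bigl => s; rewrite !inE !on_chain_perm.
Qed.

(* Every full chain through A contains exactly one superset of A of size b. *)
Lemma num_chains_flag A B : A \subset B ->
  num_chains A B * 'C(n - #|A|, #|B| - #|A|) = num_chains A A.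
Proof.
move=> sAB; set b := #|B|; have lebn : b <= n := leq_card_ord B.
have leab : #|A| <= b := subset_leq_card sAB.
pose D := [set B' : {set 'I_n} | A \subset B' & #|B'| == b].
have cardD : #|D| = 'C(n - #|A|, b - #|A|).
  (* Complements turn the members of [D] into the subsets of [~: A] of size [n - b]. *)
  have -> : n - #|A| = #|~: A| by rewrite [RHS]cardsCs setCK card_ord.
  rewrite -bin_sub; last by rewrite [leqRHS]cardsCs setCK card_ord leq_sub2r.
  rewrite -cards_draws -[RHS](card_imset _ (@setC_inj _)); apply: eq_card => C.
  rewrite -[C]setCK mem_imset; last exact: setC_inj.
  rewrite !inE setCK setCS; case: (boolP (A \subset _)) => //= sAC.
  have := subset_leq_card sAC; have := cardsC A; have := cardsC C.
  rewrite card_ord; move: leab lebn; clearbody b.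
  by move: #|C| #|~: C| #|A| #|~: A| => *; apply/eqP/eqP; lia.
rewrite -cardD mulnC -sum_nat_const.
rewrite (eq_bigr (fun B' => num_chains A B')); last first.
  by move=> B'; rewrite inE => /andP[sAB' /eqP eB']; apply: num_chains_eq.
rewrite /num_chains.
under eq_bigr do rewrite -sum1_card big_mkcond /=.
rewrite exchange_big /= -sum1_card [RHS]big_mkcond; apply: eq_bigr => s _.
rewrite inE andbb; case: (boolP (on_chain s A)) => sA; last first.
  by rewrite big1 // => B' _; rewrite inE (negPf sA).
have sD : chain_set s b \in D.
  rewrite inE card_chain_set // eqxx andbT.
  by apply: (on_chain_sub sA); rewrite ?card_chain_set // on_chain_set.
rewrite (bigD1 _ sD) /= inE sA on_chain_set // big1 // => B'.
case/andP=> DB' neB'; have : B' \in D by [].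
rewrite inE => /andP[_ /eqP eB'].
by rewrite inE sA /= /on_chain eB' eq_sym (negPf neB').
Qed.

(** This is the flag from [set0] to [A], since every permutation passes through [set0]. *)
Lemma num_chains1 A : num_chains A A * 'C(n, #|A|) = n`!.
Proof.
have p0 s : on_chain s set0.
  by rewrite /on_chain cards0 -cards_eq0 card_chain_set.
have e0 : num_chains set0 set0 = n`!.
  by rewrite /num_chains -card_Sn; apply: eq_card => s; rewrite !inE p0.
rewrite -e0 -(num_chains_flag (sub0set A)) cards0 !subn0; congr (_ * _).
by rewrite /num_chains; apply: eq_card => s; rewrite !inE andbb p0.
Qed.

End FullChains.

(** * Binomial coefficients near the middle and far from it *)

Section Binomials.
Local Open Scope nat_scope.

Lemma leq_bin_mid n m : 'C(n, m) <= 'C(n, n./2).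
Proof.
have up i : i <= n./2 -> 'C(n, n./2 - i) <= 'C(n, n./2).
  elim: i => [|i IH] lei; first by rewrite subn0.
  apply: leq_trans (IH (ltnW lei)).
  set j := n./2 - i.+1; have -> : n./2 - i = j.+1 by lia.
  rewrite -(leq_pmul2l (ltn0Sn j)) mul_bin_left leq_mul2r.
  by apply/orP; right; lia.
have [lemn|] := leqP m n; last by move/bin_small->.
have [lem|ltm] := leqP m n./2; first by rewrite -(subKn lem) up ?leq_subr.
have lem : n - m <= n./2 by lia.
by rewrite -bin_sub // -(subKn lem) up ?leq_subr.
Qed.

Lemma leq_bin n m : 0 < m < n -> n <= 'C(n, m).
Proof.
elim: n m => [|n IH] [|m] //=; rewrite ltnS => ltmn; rewrite binS.
have c0 : 0 < 'C(n, m) by rewrite bin_gt0 ltnW.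
move: ltmn; rewrite leq_eqVlt => /orP[/eqP <-|ltmn]; last first.
  by have := IH m.+1 ltmn; lia.
by rewrite binn add1n ltnS; case: m c0 => // m _; rewrite binSn.
Qed.

(** For bounded [j] this makes level [j] negligible against the middle level as [n] grows. *)
Lemma bin_tail n j : (n - j) * 'C(n, j) <= j.+1 * 'C(n, n./2).
Proof. by rewrite -mul_bin_left leq_mul2l leq_bin_mid orbT. Qed.

(* 'C(n, m) - 'C(n, m + 1) = (2 m + 1 - n) / (m + 1) * 'C(n, m), summed over
   m = n./2, ..., n./2 + i - 1. *)
Lemma bin_near_mid n i :
  n.+1 * 'C(n, n./2) <= n.+1 * 'C(n, n./2 + i) + (i * i.*2.+1).*2 * 'C(n, n./2).
Proof.
elim: i => [|i IH]; first by rewrite addn0 leq_addr.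
have := leq_bin_mid n (n./2 + i); have := mul_bin_left n (n./2 + i).
rewrite addnS.
have : n.+1 <= (n./2 + i).+1.*2 by lia.
have : (n./2 + i).+1 <= n - (n./2 + i) + i.*2.+1 by lia.
move: (n - _) IH; move: 'C(n, n./2) 'C(n, n./2 + i) 'C(n, (n./2 + i).+1).
move: (n./2 + i).+1 n.+1 => m N c a b d IH h1 h2 e1 h3.
(* [c], [a], [b] are the binomials at [n./2], [n./2 + i] and [n./2 + i + 1], so that
   [m * b = d * a]. The bound [N <= m.*2] later turns a loss relative to [m] into one relative to
   [N]. *)
have h4 : m * a <= m * b + i.*2.+1 * a by rewrite e1 -mulnDl leq_mul2r h1 orbT.
have h5 : m * a <= m * b + i.*2.+1 * c.
  by apply: leq_trans h4 _; rewrite leq_add2l leq_mul2l h3 orbT.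
have h6 : N * a <= N * b + i.*2.+1.*2 * c.
  have [leab|ltba] := leqP a b.
    by apply: leq_trans (leq_addr _ _); rewrite leq_mul2l leab orbT.
  have : m * (a - b) <= i.*2.+1 * c by rewrite mulnBr; lia.
  have : N * (a - b) <= m.*2 * (a - b) by rewrite leq_mul2r h2 orbT.
  have : N * a = N * (a - b) + N * b by rewrite -mulnDr subnK // ltnW.
  rewrite -!muln2; nia.
nia.
Qed.

End Binomials.

(** * Counting full chains when the few sets in [S A] block all [h]-chains of [F] above [A] *)

Section Lubell.
Import mathcomp.boot.fintype mathcomp.boot.finset.
Local Open Scope nat_scope.

(** Induction on [k]: a sequence in [P] avoiding all those chosen so far extends the disjoint
    family. If there is none, the entries chosen so far meet every sequence in [P]. *)
Lemma disjoint_or_blocking (T : eqType) (P : pred (seq T)) h k :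
    (forall t, P t -> size t = h) ->
  (exists ts, [/\ size ts = k, all P ts &
     forall i j, i < j < k -> ~~ has (mem (nth [::] ts i)) (nth [::] ts j)]) \/
  (exists S, [/\ size S <= k * h, {in S, forall x, exists2 t, P t & x \in t} &
     forall t, P t -> has (mem S) t]).
Proof.
move=> sizeP; elim: k => [|k [[ts [sts Pts dts]]|[S [sS inS hitS]]]].
- by left; exists [::]; split=> // i j; rewrite ltn0 andbF.
- have [[t [Pt dt]]|noT] := EM (exists t, P t /\ ~ has (mem (flatten ts)) t).
    left; exists (t :: ts); split=> /=; rewrite ?sts ?Pt //.
    case=> [|i] [|j] //=; last exact: dts.
    rewrite ltnS -sts => ltj; apply/negP.
    case/hasP => x xs xt; apply: dt; apply/hasP; exists x => //.
    by apply/flattenP; exists (nth [::] ts j); rewrite ?mem_nth.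
  right; exists (flatten ts); split.
  + have -> : size (flatten ts) = k * h.
      rewrite -sts; elim: ts Pts {sts dts noT} => //= s ts IH /andP[Ps Pts].
      by rewrite size_cat IH // (sizeP s Ps) mulSn.
    by rewrite leq_mul2r leqnSn orbT.
  + move=> x /flattenP[t t_ts xt]; exists t => //.
    exact: (allP Pts).
  + by move=> t Pt; apply: contrapT => ht; apply: noT; exists t.
- right; exists S; split=> //; apply: leq_trans sS _.
  by rewrite leq_mul2r leqnSn orbT.
Qed.

Variables (n : nat) (F : {set {set 'I_n}}).

Definition chain_above (h : nat) (A : {set 'I_n}) (t : seq {set 'I_n}) :=
  [&& size t == h, all (fun X => X \in F) t &
      path (fun X Y : {set 'I_n} => X \proper Y) A t].

Variables (h c M : nat) (S : {set 'I_n} -> seq {set 'I_n}).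
Hypothesis leF : {in F, forall A : {set 'I_n}, #|A| + M <= n}.
Hypothesis sizeS : {in F, forall A, size (S A) <= c}.
Hypothesis sub_S : {in F, forall A,
  {in S A, forall B : {set 'I_n}, B \in F /\ A \proper B}}.
Hypothesis hitS : {in F, forall A t, chain_above h A t -> has (mem (S A)) t}.

(** A member [A] of [F] on the chain that has a set of [S A] on the chain too is paid for by the
    double sum; at most [h] others can occur. *)
Lemma card_on_chain (s : {perm 'I_n}) :
  \sum_(A in F) on_chain s A <=
    h + \sum_(A in F) \sum_(B <- S A) (on_chain s A && on_chain s B).
Proof.
pose W := [set A in F | on_chain s A & ~~ has (on_chain s) (S A)].
(* More than h sets of W would form a chain whose least member A starts an
   h-chain of F, which meets S A in a member of s, contrary to A \in W. *)
have cardW : #|W| <= h.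
  rewrite leqNgt; apply/negP => ltW.
  pose w := sort (fun A B : {set 'I_n} => #|A| <= #|B|) (enum W).
  have memw A : (A \in w) = (A \in W) by rewrite mem_sort mem_enum.
  have uw : uniq w by rewrite sort_uniq enum_uniq.
  have sw : size w = #|W| by rewrite size_sort -cardE.
  have pw : sorted (fun X Y : {set 'I_n} => X \proper Y) w.
    apply/(sortedP set0) => i lti.
    have wi : nth set0 w i \in W by rewrite -memw mem_nth // ltnW.
    have wi1 : nth set0 w i.+1 \in W by rewrite -memw mem_nth.
    rewrite properEneq nth_uniq ?(ltnW lti) // neq_ltn ltnSn /=.
    move: wi wi1; rewrite !inE => /and3P[_ si _] /and3P[_ si1 _].
    apply: (on_chain_sub si si1).
    have tot : total (fun A B : {set 'I_n} => #|A| <= #|B|).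
      by move=> X Y; apply: leq_total.
    by have /(sortedP set0) := sort_sorted tot (enum W); apply.
  case ew: w sw pw memw => [|A t] /= sw pw memw; first by rewrite -sw in ltW.
  have AW : A \in W by rewrite -memw mem_head.
  move: (AW); rewrite inE => /and3P[AF sA /negP]; apply.
  have /hasP[B Bt BS] : has (mem (S A)) (take h t).
    apply: hitS => //; apply/and3P; split.
    - by rewrite size_takel // -ltnS sw.
    - apply/allP => X /mem_take Xt; have : X \in W by rewrite -memw inE Xt orbT.
      by rewrite inE => /andP[].
    - exact: take_path.
  apply/hasP; exists B => //.
  have : B \in W by rewrite -memw inE (mem_take Bt) orbT.
  by rewrite inE => /and3P[].
apply: leq_trans (leq_add cardW (leqnn _)).
rewrite -sum1_card (big_setID W) /= [X in _ <= _ + X](big_setID W) /=.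
have /setIidPr -> : W \subset F by apply/subsetP => A; rewrite inE => /andP[].
have -> : \sum_(i in W) on_chain s i = \sum_(i in W) 1.
  by apply: eq_bigr => A; rewrite inE => /and3P[_ ->].
rewrite leq_add2l; apply: leq_trans (leq_addl _ _); apply: leq_sum => A.
rewrite !inE => /andP[+ AF]; rewrite AF /=.
case: (on_chain s A) => //=; rewrite negbK.
by case/hasP => B BS sB; rewrite (big_rem B) //= sB.
Qed.

Lemma sum_on_chain (A : {set 'I_n}) :
  \sum_(s : {perm 'I_n}) on_chain s A = num_chains A A.
Proof.
rewrite /num_chains -sum1_card [RHS]big_mkcond; apply: eq_bigr => s _.
by rewrite inE andbb; case: on_chain.
Qed.

(** By [num_chains_flag] the ratio of the counts is a binomial coefficient. For positive [M] its
    lower index lies strictly between 0 and [n - #|A|], so it is at least [n - #|A|], hence at least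
    [M]. *)
Lemma leq_num_chains (A B : {set 'I_n}) : A \proper B -> #|B| + M <= n ->
  M * num_chains A B <= num_chains A A.
Proof.
move=> pAB leB; have ltAB := proper_card pAB.
rewrite -(num_chains_flag (proper_sub pAB)) mulnC leq_mul2l; apply/orP; right.
have [->//|M0] := posnP M.
apply: leq_trans (_ : n - #|A| <= _); first lia.
by apply: leq_bin; lia.
Qed.

Lemma lubell_bound : (M - c) * #|F| <= M * h * 'C(n, n./2).
Proof.
(* [N] is n! times the expected number of members of [F] on a random full chain. *)
pose N := \sum_(A in F) num_chains A A.
have bound : M * N <= M * (h * n`!) + c * N.
  have step : N <= h * n`! + \sum_(A in F) \sum_(B <- S A) num_chains A B.
    rewrite /N (eq_bigr _ (fun A _ => esym (sum_on_chain A))) exchange_big /=.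
    apply: (@leq_trans (\sum_(s : {perm 'I_n}) (h +
        \sum_(A in F) \sum_(B <- S A) (on_chain s A && on_chain s B)))).
      by apply: leq_sum => s _; apply: card_on_chain.
    rewrite big_split /= sum_nat_const mulnC card_Sn leq_add2l.
    rewrite exchange_big /=; apply: leq_sum => A _; rewrite exchange_big /=.
    apply: leq_sum => B _; rewrite /num_chains -[X in _ <= X]sum1_card.
    rewrite [X in _ <= X]big_mkcond; apply: leq_sum => s _.
    by rewrite inE; case: andb.
  apply: leq_trans (leq_mul (leqnn M) step) _.
  rewrite mulnDr leq_add2l !big_distrr /=; apply: leq_sum => A AF.
  rewrite big_distrr /=.
  apply: leq_trans (_ : \sum_(B <- S A) num_chains A A <= _).
    rewrite !big_seq; apply: leq_sum => B /(sub_S AF)[BF pAB].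
    exact: leq_num_chains (leF BF).
  by rewrite big_const_seq count_predT iter_addn_0 mulnC leq_mul2r sizeS ?orbT.
(* The LYM argument: [A] lies on n! divided by ['C(n, #|A|)] full chains, and this binomial is at
   most the middle one. *)
have lowN : #|F| * n`! <= N * 'C(n, n./2).
  rewrite -sum_nat_const big_distrl; apply: leq_sum => A _ /=.
  by rewrite -(num_chains1 A) leq_mul2l leq_bin_mid orbT.
rewrite -(leq_pmul2r (fact_gt0 n)) -mulnA.
apply: leq_trans (leq_mul (leqnn (M - c)) lowN) _.
rewrite mulnA [leqRHS]mulnAC leq_mul2r mulnBl leq_subLR addnC.
by rewrite -mulnA bound orbT.
Qed.

End Lubell.

(** * Fans in families of sets and in consecutive levels *)

Section Fans.
Import mathcomp.boot.fintype mathcomp.boot.finset.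
Local Open Scope nat_scope.

Variables (l : seq nat) (h : nat).
Hypothesis leh : forall i, (nth 0 l i).-1 <= h.

(** The common minimum goes to [A], and the rest of the [i]-th chain of the fan to the first sets of
    the [i]-th [h]-chain. Disjointness gives injectivity across chains. *)
Lemma contains_fan n (F : {set {set 'I_n}}) A ts :
    A \in F -> size ts = size l -> all (chain_above F h A) ts ->
    (forall i j, i < j < size l ->
       ~~ has (mem (nth [::] ts i)) (nth [::] ts j)) ->
  contains_poset F (fan l).
Proof.
move=> AF sts /all_nthP chts dts.
pose t i := nth [::] ts i.
have tP (i : 'I_(size l)) :
    [/\ size (t i) = h, {in t i, forall X : {set 'I_n}, X \in F}, uniq (t i),
        {in t i, forall X : {set 'I_n}, A \proper X} &
        {in gtn h &, {homo nth set0 (t i) : j k / j < k >-> j \proper k}}].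
  have lti : i < size ts by rewrite sts.
  have /and3P[/eqP sti /allP tF pt] := chts [::] i lti.
  have trp : transitive (fun X Y : {set 'I_n} => X \proper Y).
    by move=> Y X Z; apply: proper_trans.
  have st := path_sorted pt; split=> //.
  - by apply: sorted_uniq st => // X; rewrite properxx.
  - exact: (allP (order_path_min trp pt)).
  - by rewrite -sti => j k ltj ltk; apply: (sorted_ltn_nth trp).
have rk (u : {i : 'I_(size l) & 'I_(nth 0 l i).-1}) : tagged u < h.
  by case: u => i j /=; apply: leq_trans (ltn_ord j) (leh i).
pose f (x : fan l) : {set 'I_n} :=
  if x is Some u then nth set0 (t (tag u)) (tagged u) else A.
have ft u : f (Some u) \in t (tag u).
  by case: (tP (tag u)) => st *; rewrite mem_nth // st rk.
exists f; split.
- have nA u : f (Some u) <> A.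
    move=> fA; case: (tP (tag u)) => _ _ _ /(_ _ (ft u)) + _.
    by rewrite fA properxx.
  have tagf u v : f (Some u) = f (Some v) -> ~ (tag u < tag v).
    move=> fuv ltuv; have := dts (tag u) (tag v).
    rewrite ltuv ltn_ord => /(_ isT) /negP; apply; apply/hasP.
    by exists (f (Some v)); [exact: ft | move: (ft u); rewrite fuv].
  move=> [u|] [v|] //; [move=> fuv | by move/nA | by move/esym/nA].
  have tuv : tag u = tag v.
    apply/val_inj/eqP; case: ltngtP => //; first by move/(tagf _ _ fuv).
    by move/(tagf _ _ (esym fuv)).
  case: u v fuv tuv {tagf nA} => i j [i' j'] + /= eii'.
  case: _ / eii' j' => j' /=; case: (tP i) => st _ ut _ _ /eqP.
  have rj := rk (existT _ i j); have rj' := rk (existT _ i j').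
  rewrite nth_uniq ?st // => /eqP jj'.
  by congr (Some (existT _ i _)); apply/val_inj.
- case=> [u|] //; case: (tP (tag u)) => _ tF _ _ _; exact/tF/ft.
- case=> [u|] [v|] //.
  + rewrite [(_ <= _)%O]/=; case/andP.
    case: u v => i j [i' j'] /= /eqP eii'; case: _ / eii' j' => j' /=.
    rewrite leq_eqVlt => /orP[/eqP -> //|ltjj'].
    case: (tP i) => _ _ _ _ /(_ _ _ _ _ ltjj') pr; apply/proper_sub/pr.
    * exact: (rk (existT _ i j)).
    * exact: (rk (existT _ i j')).
  + by move=> _; apply: proper_sub; case: (tP (tag v)) => _ _ _ /(_ _ (ft v)).
Qed.

(** Since [size l] disjoint [h]-chains above [A] would give a fan, [disjoint_or_blocking] must end
    in its blocking alternative, which supplies the sets [S A] for [lubell_bound]. *)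
Lemma fan_free_bound n (F : {set {set 'I_n}}) M :
    poset_free (fan l) F -> {in F, forall A : {set 'I_n}, #|A| + M <= n} ->
  (M - size l * h) * #|F| <= M * h * 'C(n, n./2).
Proof.
move=> freeF leF.
(* The condition [A \in F] stands under the existential so that a choice function exists on all
   sets. *)
have blk (A : {set 'I_n}) : exists S : seq {set 'I_n}, A \in F ->
    [/\ size S <= size l * h,
        {in S, forall B : {set 'I_n}, B \in F /\ A \proper B} &
        forall t, chain_above F h A t -> has (mem S) t].
  case: (boolP (A \in F)) => AF; last by exists [::].
  have szP t : chain_above F h A t -> size t = h by case/and3P=> /eqP.
  have [[ts [sts cts dts]]|[S [sS inS hS]]] :=
    disjoint_or_blocking (size l) szP.
    by case: freeF; apply: contains_fan cts dts.
  exists S => _; split=> // B /inS[t /and3P[_ /allP tF pt] Bt]; split.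
    exact: tF.
  have trp : transitive (fun X Y : {set 'I_n} => X \proper Y).
    by move=> Y X Z; apply: proper_trans.
  exact: (allP (order_path_min trp pt)).
have [S hS] := boolp.choice blk.
apply: (@lubell_bound n F h _ M S) => // A AF; have [? ? ?] := hS A AF => //.
Qed.

(** The complements of these sets have sizes [j < M], and [bin_tail] bounds each of these [M]
    levels. *)
Lemma card_small_codim n M : M < n ->
  (n - M) * #|[set A : {set 'I_n} | n < #|A| + M]| <= M * M * 'C(n, n./2).
Proof.
move=> ltMn; rewrite -sum1_card.
apply: (@leq_trans ((n - M) * \sum_(j < M) 'C(n, j))).
  rewrite leq_mul2l; apply/orP; right.
  rewrite (eq_bigr (fun j : 'I_M => \sum_(A : {set 'I_n} | #|~: A| == j) 1)).
    rewrite (exchange_big_dep xpredT) //= big_mkcond /=; apply: leq_sum => A _.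
    rewrite inE; case: ifP => // ltA.
    have ltM : #|~: A| < M.
      have := cardsC A; rewrite card_ord; move: ltA.
      by move: #|A| #|~: A| => a b; lia.
    by rewrite (bigD1 (Ordinal ltM)) //=.
  move=> j _; rewrite -[n in 'C(n, _)]card_ord -card_draws -sum1_card.
  rewrite (reindex_inj (@setC_inj _)) /=; apply: eq_bigl => A.
  by rewrite inE.
rewrite big_distrr /= -mulnA -[X in _ <= X * _]card_ord -sum_nat_const.
apply: leq_sum => j _; apply: leq_trans (_ : j.+1 * 'C(n, n./2) <= _).
  apply: leq_trans (bin_tail n j).
  by rewrite leq_mul2r leq_sub2l ?orbT // ltnW.
by rewrite leq_mul2r ltn_ord orbT.
Qed.

Lemma mem_consecutive_levels n s m (A : {set 'I_n}) :
  (A \in consecutive_levels n s m) = (s <= #|A|%:Z < s + m%:Z)%R.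
Proof.
apply/bigcupP/idP => [[i _]|]; first
  by rewrite inE => /eqP; have := ltn_ord i; lia.
case/andP=> leA ltA; have ltm : absz (#|A|%:Z - s)%R < m by lia.
exists (Ordinal ltm) => //; rewrite inE /=; apply/eqP.
by move: leA; move: #|A| => a; lia.
Qed.

Lemma card_consecutive_levels n s m :
  #|consecutive_levels n s%:Z m| = \sum_(i < m) 'C(n, s + i).
Proof.
elim: m => [|m IH]; first by rewrite /consecutive_levels !big_ord0 cards0.
rewrite big_ord_recr /= -IH -[n in 'C(n, _)]card_ord -card_draws -cardsUI.
rewrite [_ :&: _](_ : _ = set0) ?cards0 ?addn0.
  apply: eq_card => A; rewrite inE !mem_consecutive_levels inE.
  by move: #|A| => a; apply/idP/idP; lia.
by apply/setP=> A; rewrite !inE mem_consecutive_levels; move: #|A| => a; lia.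
Qed.

(** Sizes grow strictly along the image of the first chain, so its [nth 0 l 0] sets need as many
    levels. *)
Lemma fan_levels_free (l0 : 0 < size l) : levels_free (fan l) (nth 0 l 0).-1.
Proof.
move=> n s [f [injf fF mono]].
pose i0 := Ordinal l0.
have lt_f (x y : fan l) : (x < y)%O -> #|f x| < #|f y|.
  move=> ltxy; apply: proper_card; rewrite properEneq mono ?ltW // andbT.
  by apply/eqP => /injf exy; rewrite exy ltxx in ltxy.
have f0 := fF None; rewrite mem_consecutive_levels in f0.
have low j (ltj : j < (nth 0 l i0).-1) :
    (s + j.+1%:Z <= #|f (Some (existT _ i0 (Ordinal ltj)))|%:Z)%R.
  elim: j ltj => [|j IH] ltj.
    have := lt_f None (Some (existT _ i0 (Ordinal ltj))) isT; lia.
  have := IH (ltnW ltj).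
  have : (Some (existT _ i0 (Ordinal (ltnW ltj))) <
          Some (existT _ i0 (Ordinal ltj)) :> fan l)%O.
    rewrite lt_neqAle; apply/andP; split; last first.
      by change (is_true ((i0 == i0) && (j <= j.+1))); rewrite eqxx leqnSn.
    pose r (x : fan l) : nat := if x is Some u then tagged u else 0.
    by apply/eqP => /(congr1 r) /=; lia.
  move/lt_f; lia.
(* That [f None] lies in some level forces the number of levels to be positive, so the first chain
   has a top element above the minimum. *)
have lt0 : (nth 0 l i0).-1.-1 < (nth 0 l i0).-1 by move: f0; rewrite /=; lia.
have := fF (Some (existT _ i0 (Ordinal lt0))); rewrite mem_consecutive_levels.
have := low _ lt0; move: lt0 => /=; lia.
Qed.

(** Each element is sent to its down-set in the fan, which has between 1 and [h + 1] elements and so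
    lies in the levels 1 to [m]. *)
Lemma fan_not_levels_free m : h < m -> ~ levels_free (fan l) m.
Proof.
move=> ltm free; apply: (free #|{: fan l}| 1%R).
exists (fun x : fan l => [set i | (enum_val i <= x)%O]); split.
- move=> x y /setP exy; apply/le_anti/andP; split.
    by have := exy (enum_rank x); rewrite !inE enum_rankK lexx => <-.
  by have := exy (enum_rank y); rewrite !inE enum_rankK lexx => ->.
- move=> x; rewrite mem_consecutive_levels.
  set D := [set i | _].
  have D0 : 0 < #|D|.
    by apply/card_gt0P; exists (enum_rank x); rewrite inE enum_rankK lexx.
  (* The elements below [x] lie on a single chain, so the rank [r] is injective on [D]. *)
  pose r (y : fan l) : nat := if y is Some u then (tagged u).+1 else 0.
  have ltr y : r y < h.+1.
    case: y => [[i j]|] //=; rewrite ltnS.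
    exact: leq_trans (ltn_ord j) (leh i).
  pose g (i : 'I_#|{: fan l}|) := Ordinal (ltr (enum_val i)).
  have injg : {in D &, injective g}.
    move=> i i'; rewrite !inE => lei lei' /(congr1 val) /= er.
    apply: enum_val_inj; move: lei lei' er.
    case: (enum_val i) (enum_val i') x {D D0 g} =>
      [[a j]|] [[a' j']|] [[b k]|] //=.
    rewrite ![(_ <= _)%O]/= => /andP[/eqP /= ea _] /andP[/eqP /= ea' _] [ej].
    have eaa : a = a' by rewrite ea.
    case: _ / eaa j' ej {ea'} => j' ej.
    by congr (Some (existT _ a _)); apply/val_inj.
  have : #|D| <= h.+1.
    by rewrite -(card_in_imset injg) -[leqRHS]card_ord max_card.
  by move: D0; move: #|D| => a; lia.
- move=> x y xy; apply/subsetP => i; rewrite !inE => lei.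
  exact: le_trans lei xy.
Qed.

End Fans.

(** * Bounds on [La] from both sides for fixed [n] *)

Section LaBounds.
Import mathcomp.boot.fintype mathcomp.boot.finset.
Local Open Scope nat_scope.

(** The [h] levels from [n./2] upwards are [P]-free. [bin_near_mid] is applied to each of them, with
    its error enlarged to the value at [i = h]. *)
Lemma La_ge d (P : finPOrderType d) h n : levels_free P h ->
  n.+1 * (h * 'C(n, n./2)) <=
    n.+1 * La n P + h * (h * h.*2.+1).*2 * 'C(n, n./2).
Proof.
move=> freeP.
have low : \sum_(i < h) 'C(n, n./2 + i) <= La n P.
  rewrite -card_consecutive_levels.
  by apply: leq_bigmax_cond; apply/asboolP; apply: freeP.
apply: leq_trans (leq_add (leq_mul (leqnn _) low) (leqnn _)).
rewrite -[X in X * 'C(n, _)]card_ord -sum_nat_const !big_distrr /=.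
rewrite -mulnA -[X in _ + X * _]card_ord -sum_nat_const -big_split /=.
apply: leq_sum => i _; apply: leq_trans (bin_near_mid n i) _.
have lti := ltn_ord i.
rewrite leq_add2l leq_mul2r; apply/orP; right.
by rewrite leq_double leq_mul ?ltnS ?leq_double // ltnW.
Qed.

(** With [M = size l * h + t], [a] counts the members of size at most [n - M] of an extremal family,
    and [b] all larger sets. The factor [t] is what remains of [M] after the subtraction in
    [fan_free_bound]. *)
Lemma La_fan_le (l : seq nat) h n t :
    (forall i, (nth 0 l i).-1 <= h) -> size l * h + t < n ->
  exists a b, [/\ La n (fan l) <= a + b,
    t * a <= (size l * h + t) * h * 'C(n, n./2) &
    (n - (size l * h + t)) * b <=
      (size l * h + t) * (size l * h + t) * 'C(n, n./2)].
Proof.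
move=> leh; set M := size l * h + t => ltMn.
have [F freeF eF] : exists2 F : {set {set 'I_n}},
    poset_free (fan l) F & La n (fan l) <= #|F|.
  (* The empty family is fan-free, so the maximum defining [La] is attained. *)
  have free0 : poset_free (fan l) (set0 : {set {set 'I_n}}).
    by case=> f [_ /(_ None)]; rewrite inE.
  have [|F /asboolP freeF eF] := @eq_bigmax_cond _
      [pred F : {set {set 'I_n}} | `[< poset_free (fan l) F >]] (fun F => #|F|).
    by apply/card_gt0P; exists set0; apply/asboolP.
  by exists F => //; rewrite -eF.
pose T := [set A : {set 'I_n} | n < #|A| + M].
exists #|F :\: T|, #|T|; split.
- apply: leq_trans eF _; rewrite -(cardsID T F) addnC leq_add2l.
  by apply: subset_leq_card; apply: subsetIr.
- rewrite -[t in t * _](addKn (size l * h)).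
  apply: fan_free_bound => // [|A]; last by rewrite !inE -leqNgt => /andP[].
  case=> f [injf fF mono]; apply: freeF; exists f; split=> // u.
  by have := fF u; rewrite inE => /andP[].
- exact: card_small_codim.
Qed.

End LaBounds.

(** * Passage to the limit *)

Local Open Scope ring_scope.

Lemma La_ratio_cvg (R : realType) (l : seq nat) (h : nat) :
    levels_free (fan l) h -> (forall i, ((nth 0 l i).-1 <= h)%N) ->
  (La_ratio R (fan l) n @[n --> \oo] --> (h%:R : R))%classic.
Proof.
move=> freeP leh; apply/cvgrPdist_le => eps eps0.
pose K : R := (h * (h * h.*2.+1).*2)%:R.
pose c := (size l * h)%N.
(* The main term of the upper bound is [(c + t) * h / t = h + c * h / t]; this [t], fixed before
   [n], brings the excess down to [eps / 2]. *)
have [t t0 ht] : exists2 t : nat, (0 < t)%N & c%:R * h%:R <= (eps / 2) * t%:R.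
  exists (Num.bound (c%:R * h%:R / (eps / 2))).+1 => //.
  rewrite [X in _ <= X]mulrC -ler_pdivrMr ?divr_gt0 //.
  apply: le_trans (ltW (archi_boundP _)) _; last by rewrite ler_nat leqnSn.
  by rewrite divr_ge0 ?mulr_ge0 // ltW // divr_gt0.
pose M := (c + t)%N.
near=> n.
have ltMn : (M < n)%N by near: n; exact: nbhs_infty_gt.
(* [big1] makes the error of the lower bound at most [eps]; [big2] makes the share of the sets of
   size above [n - M] at most [eps / 2]. *)
have big1 : K / eps <= n%:R by near: n; exact: nbhs_infty_ger.
have big2 : M%:R + M%:R * M%:R / (eps / 2) <= n%:R.
  by near: n; exact: nbhs_infty_ger.
have C0 : (0 : R) < 'C(n, n./2)%:R by rewrite ltr0n bin_gt0; lia.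
rewrite ler_distlC /La_ratio ler_pdivlMr // ler_pdivrMr //.
set C : R := 'C(n, n./2)%:R; set L : R := (La n (fan l))%:R.
have {}C0 : 0 < C by [].
apply/andP; split.
  have n1 : (0 : R) < n.+1%:R by rewrite ltr0n.
  have lowL : n.+1%:R * (h%:R * C) <= n.+1%:R * L + K * C.
    by rewrite -!natrM -natrD ler_nat La_ge.
  have KC : K * C <= n.+1%:R * eps * C.
    rewrite ler_pM2r // -ler_pdivrMr //.
    by apply: le_trans big1 _; rewrite ler_nat.
  rewrite -(ler_pM2l n1); lra.
have [a [b [hab ha hb]]] := La_fan_le leh ltMn.
have t1 : (0 : R) < t%:R by rewrite ltr0n.
have nM : (0 : R) < n%:R - M%:R by rewrite subr_gt0 ltr_nat.
have habR : L <= a%:R + b%:R by rewrite -natrD ler_nat.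
have haR : t%:R * a%:R <= M%:R * h%:R * C by rewrite -!natrM ler_nat.
have hbR : (n%:R - M%:R) * b%:R <= M%:R * M%:R * C.
  by rewrite -natrB ?(ltnW ltMn) // -!natrM ler_nat.
have leb : b%:R <= eps / 2 * C.
  rewrite -(ler_pM2l nM); apply: le_trans hbR _.
  rewrite mulrA ler_pM2r // -ler_pdivrMr ?divr_gt0 // lerBrDl //.
have lea : a%:R <= (h%:R + eps / 2) * C.
  rewrite -(ler_pM2l t1); apply: le_trans haR _.
  rewrite mulrA ler_pM2r // natrD; lra.
by apply: le_trans habR _; lra.
Unshelve. all: by end_near.
Qed.

Theorem corollary5p2 (R : realType) (k : nat) (l : k.-tuple nat)
    (hk : (1 <= k)%N) (hsorted : sorted geq l)
    (hge2 : forall i : 'I_k, (2 <= tnth l i)%N) :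
  [/\ cvgn (La_ratio R (fan l)),
      poset_pi R (fan l) = (e (fan l))%:R
    & e (fan l) = (nth 0 l 0 - 1)%N].
Proof.
have l0 : (0 < size l)%N by rewrite size_tuple.
(* The index [i] ranges over all naturals: past the end [nth] returns 0, whose predecessor is again
   0. *)
have leh i : ((nth 0 l i).-1 <= (nth 0 l 0).-1)%N.
  have [lti|] := ltnP i (size l); last by move/(nth_default 0) ->.
  have [->//|i0] := posnP i.
  have trg : transitive geq by move=> x y z /= xy yz; apply: leq_trans yz xy.
  by have /= := sorted_ltn_nth trg 0%N hsorted 0%N i l0 lti i0; lia.
have freeP := fan_levels_free l0.
have eP : e (fan l) = (nth 0 l 0 - 1)%N.
  have [fe maxe] := e_spec (None : fan l).
  rewrite subn1; apply/eqP; rewrite eqn_leq maxe // andbT leqNgt.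
  by apply/negP => lth; apply: (fan_not_levels_free leh lth).
have cv := @La_ratio_cvg R _ _ freeP leh.
split=> //; first by apply/cvg_ex; exists (nth 0 l 0).-1%:R.
by rewrite eP subn1; apply: cvg_lim.
Qed.
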